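(* Let $\mathbb{F}$ be a field of characteristic $0$. If $\mathrm{sdet}_{2n}(X)$, with $X=\{x_{ij}:1\le i,j\le 2n\}$, can be computed by polynomial-size (in $n$) noncommutative arithmetic circuits over $\mathbb{F}$, then $\mathrm{Cperm}_n(Y)$, with $Y=\{y_{ij}:1\le i,j\le n\}$, can also be computed by polynomial-size noncommutative arithmetic circuits over $\mathbb{F}$.
   Context: All variables are noncommuting. The symmetrized determinant is $\mathrm{sdet}_N(X)=\frac{1}{N!}\sum_{\sigma,\tau\in S_N}\mathrm{sgn}(\sigma)\mathrm{sgn}(\tau)\,x_{\tau(1),\sigma(1)}x_{\tau(2),\sigma(2)}\cdots x_{\tau(N),\sigma(N)}$ and the Cayley permanent is $\mathrm{Cperm}_n(Y)=\sum_{\sigma\in S_n}y_{1,\sigma(1)}\cdots y_{n,\sigma(n)}$ (products in written order). A noncommutative arithmetic circuit over $\mathbb{F}$ is a directed acyclic graph with leaves labelled by variables or field elements and internal fan-in-two addition and multiplication gates, each multiplication gate having ordered (left, right) children; it computes a polynomial in the free noncommutative polynomial ring at a designated output gate; its size is the number of nodes. *)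

(* Defs.v *)
From HB Require Import structures.
From mathcomp Require Import all_boot all_order all_fingroup all_algebra.
From mathcomp.multinomials Require Export monalg.

Set Implicit Arguments.
Unset Strict Implicit.
Unset Printing Implicit Defensive.

Import GRing.Theory.
Local Open Scope ring_scope.

(* Free noncommutative polynomial ring F<I>: the monoid algebra over F of the
   free monoid {fmonom I} of words over I. *)
Notation "{ 'ncpoly' F [ I ] }" := {malg F[{fmonom I%type}]}
  (at level 0, F, I at level 2, format "{ 'ncpoly'  F [ I ] }") : type_scope.

Definition ncvar (F : fieldType) (I : choiceType) (i : I) : {ncpoly F[I]} :=
  << fmu i >>.

(* The \prod below run over 'I_N in increasing order, so factors are multiplied
   in written order although the entries do not commute. *)
Definition sdet (F : fieldType) (A : lalgType F) (N : nat) (X : 'M[A]_N) : A :=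
  (N`!%:R : F)^-1 *:
    \sum_(s : 'S_N) \sum_(t : 'S_N)
      ((-1) ^+ s * (-1) ^+ t) * \prod_(k < N) X (t k) (s k).

Definition Cperm (A : nzRingType) (n : nat) (Y : 'M[A]_n) : A :=
  \sum_(s : 'S_n) \prod_(k < n) Y k (s k).

Definition generic_mx (F : fieldType) (n : nat) :
    'M[{ncpoly F['I_n * 'I_n]}]_n :=
  \matrix_(i, j) ncvar F (i, j).

Variant gate (F I V : Type) :=
  | GConst of F
  | GVar of I
  | GAdd of V & V
  | GMul of V & V.

Arguments GConst {F I V}.
Arguments GVar {F I V}.
Arguments GAdd {F I V}.
Arguments GMul {F I V}.

Definition children (F I V : Type) (g : gate F I V) : seq V :=
  match g with
  | GConst _ | GVar _ => [::]
  | GAdd u v | GMul u v => [:: u; v]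
  end.

Record circuit (F : fieldType) (I : choiceType) := Circuit {
  node : finType;
  label : node -> gate F I node;
  output : node;
  (* [path.cycle] also holds of the empty sequence; self-loops are excluded. *)
  acyclic : forall c : seq node,
    path.cycle (fun u v => v \in children (label u)) c -> c = [::]
}.

Definition circuit_size (F : fieldType) (I : choiceType) (C : circuit F I) :
  nat := #|node C|.

Inductive node_value (F : fieldType) (I : choiceType) (C : circuit F I) :
    node C -> {ncpoly F[I]} -> Prop :=
  | ValConst v a :
      label v = GConst a -> node_value v a%:MP
  | ValVar v i :
      label v = GVar i -> node_value v (ncvar F i)
  | ValAdd v l r p q :
      label v = GAdd l r -> node_value l p -> node_value r q ->
      node_value v (p + q)
  | ValMul v l r p q :
      label v = GMul l r -> node_value l p -> node_value r q ->
      node_value v (p * q).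

Definition computes (F : fieldType) (I : choiceType) (C : circuit F I)
    (p : {ncpoly F[I]}) : Prop :=
  node_value (output C) p.

Lemma node_value_uniq (F : fieldType) (I : choiceType) (C : circuit F I)
    (v : node C) (p q : {ncpoly F[I]}) :
  node_value v p -> node_value v q -> p = q.
Proof.
move=> vp; elim: vp q => {v p}.
- by move=> v a Ev q vq; case: vq Ev => [v' b|v' i|v' l r p1 p2|v' l r p1 p2] -> // [->].
- by move=> v i Ev q vq; case: vq Ev => [v' b|v' j|v' l r p1 p2|v' l r p1 p2] -> // [->].
- move=> v l r p1 p2 Ev _ IHl _ IHr q vq.
  case: vq Ev => [v' b|v' j|v' l' r' q1 q2|v' l' r' q1 q2] -> //.
  by move=> vl vr [El Er]; rewrite (IHl q1) ?(IHr q2) // -?El -?Er.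
- move=> v l r p1 p2 Ev _ IHl _ IHr q vq.
  case: vq Ev => [v' b|v' j|v' l' r' q1 q2|v' l' r' q1 q2] -> //.
  by move=> vl vr [El Er]; rewrite (IHl q1) ?(IHr q2) // -?El -?Er.
Qed.

Lemma node_value_ex (F : fieldType) (I : choiceType) (C : circuit F I)
    (v : node C) :
  exists p : {ncpoly F[I]}, node_value v p.
Proof.
set e := fun u v : node C => v \in children (label u).
have [m] := ubnP #|connect e v|.
elim: m v => // m IHm v ltvm.
have IH w : e v w -> exists p : {ncpoly F[I]}, node_value w p.
  move=> evw; apply: IHm; rewrite ltnS in ltvm.
  apply: leq_trans ltvm; apply/proper_card/properP; split.
    by apply/subsetP=> u; apply: connect_trans; apply: connect1.
  exists v; first exact: connect0.
  apply/negP=> /connectP[s ps Es].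
  have: path.cycle e (w :: s) by rewrite /= rcons_path ps -Es.
  by move/(@acyclic _ _ C).
case Ev: (label v) => [a|i|l r|l r].
- by exists a%:MP; apply: ValConst Ev.
- by exists (ncvar F i); apply: ValVar Ev.
- have [|p lp] := IH l; first by rewrite /e Ev inE eqxx.
  have [|q rq] := IH r; first by rewrite /e Ev !inE eqxx orbT.
  by exists (p + q); apply: ValAdd Ev lp rq.
- have [|p lp] := IH l; first by rewrite /e Ev inE eqxx.
  have [|q rq] := IH r; first by rewrite /e Ev !inE eqxx orbT.
  by exists (p * q); apply: ValMul Ev lp rq.
Qed.

(* A bound "polynomial in n" is [b.[n]] for a fixed [b] with coefficients in
   nat; the circuit may depend arbitrarily on n (non-uniform families). *)
Definition poly_size_computable (F : fieldType) (I : nat -> choiceType)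
    (f : forall n, {ncpoly F[I n]}) : Prop :=
  exists b : {poly nat}, forall n, exists C : circuit F (I n),
    (circuit_size C <= b.[n])%N /\ computes C (f n).

(* Main.v *)
Require Import Defs.
From HB Require Import structures.
From mathcomp Require Import all_boot all_order all_fingroup all_algebra.
From mathcomp Require Import zify.

(** Substitute for the variables of sdet_{2n} square matrices of size 2n^2 + 1,
    the transitions of an automaton that reads words of length 2n. It accepts
    exactly the words in which the rows occur in the order 0, 1, ..., 2n - 1
    and the columns at positions 2i and 2i + 1 form a pair 2j, 2j + 1: rows are
    tracked by the layer of the state, and j is remembered between the two
    letters. Only the terms survive where tau is the identity and sigma acts as
    one pi in S_n on both the even and the odd indices; such a sigma is always
    even. With weight y_{i,j} on even letters and r (r + 1) on the letters of
    an odd row r, each term picks up the factor (2n)!, which cancels the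
    normalization of sdet, and the (initial, final) entry is Cperm_n. A circuit
    can be evaluated on d x d matrices at the cost of a factor polynomial in d,
    by splitting each node into its d^2 entries. *)

Set Implicit Arguments.
Unset Strict Implicit.
Unset Printing Implicit Defensive.

Import GRing.Theory.
Local Open Scope ring_scope.

(** * The automaton *)

Section MatrixPaths.
Variables (R : nzRingType) (d : nat).
Implicit Types X : nat -> 'M[R]_d.+1.

(** Expand the entry over sequences of states: some summand is nonzero, hence so is each of its
    factors. *)
Lemma prod_mx_path X N p q :
  (\prod_(k < N) X k) p q != 0 ->
  exists st : nat -> 'I_d.+1, [/\ st 0%N = p, st N = q &
    forall k, (k < N)%N -> X k (st k) (st k.+1) != 0].
Proof.
elim: N q => [|N IHN] q.
  rewrite big_ord0 mxE; case: (eqVneq p q) => [-> _|]; last by rewrite eqxx.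
  by exists (fun=> q).
rewrite big_ord_recr /= mxE => nz.
have [r nzr] : exists r, (\prod_(k < N) X k) p r * X N r q != 0.
  apply/existsP; apply: contraNT nz => /existsPn z.
  by apply/eqP/big1 => r _; apply/eqP; rewrite -[_ == _]negbK.
have [|st [st0 stN stX]] := IHN r.
  by apply: contraNneq nzr => ->; rewrite mul0r.
exists (fun k => if (k <= N)%N then st k else q).
split=> [//||k]; first by rewrite ltnn.
rewrite ltnS => lekN; rewrite lekN; case: (ltngtP k N) lekN => // [ltkN|->] _.
  exact: stX.
by rewrite stN; apply: contraNneq nzr => ->; rewrite mulr0.
Qed.

(** The row of each [st k] is supported at [st k.+1], so a single path contributes. *)
Lemma prod_mx_det_path X N (st : nat -> 'I_d.+1) q :
  (forall k r, (k < N)%N -> r != st k.+1 -> X k (st k) r = 0) ->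
  (\prod_(k < N) X k) (st 0%N) q =
    (\prod_(k < N) X k (st k) (st k.+1)) *+ (st N == q).
Proof.
elim: N q => [|N IHN] q detX; first by rewrite !big_ord0 mxE.
rewrite !big_ord_recr /= mxE (bigD1 (st N)) //=.
rewrite [X in _ + X]big1 ?addr0 => [|r neq].
  rewrite IHN => [|k r ltkN]; last by apply: detX; apply: ltnW.
  rewrite eqxx mulr1n; case: (eqVneq (st N.+1) q) => [->//|neq].
  by rewrite detX ?mulr0 1?eq_sym.
rewrite IHN => [|k r' ltkN]; last by apply: detX; apply: ltnW.
by rewrite eq_sym (negbTE neq) mulr0n mul0r.
Qed.

End MatrixPaths.

(** * Indices below 2n as pairs of a half and a parity *)

Section Doubling.
Variable n : nat.

Fact half_ord_subproof (k : 'I_(2 * n)) : (k./2 < n)%N.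
Proof. have := ltn_ord k; lia. Qed.
Definition half_ord k := Ordinal (half_ord_subproof k).

Fact dbl_ord_subproof (i : 'I_n) (b : bool) : (i.*2 + b < 2 * n)%N.
Proof. have := ltn_ord i; lia. Qed.
Definition dbl_ord i b := Ordinal (dbl_ord_subproof i b).

Lemma dbl_ordK i b : half_ord (dbl_ord i b) = i.
Proof. by apply/val_inj => /=; lia. Qed.

Lemma odd_dbl_ord i b : odd (dbl_ord i b) = b.
Proof. by rewrite /=; case: b; lia. Qed.

Lemma half_ordK k : dbl_ord (half_ord k) (odd k) = k.
Proof. by apply/val_inj => /=; lia. Qed.

Lemma dbl_ord_inj i j b c : dbl_ord i b = dbl_ord j c -> i = j /\ b = c.
Proof.
move=> e; split; first by rewrite -(dbl_ordK i b) e dbl_ordK.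
by rewrite -(odd_dbl_ord i b) e odd_dbl_ord.
Qed.

(** [A] selects the parities on which [s] acts: [predT] gives both, [id] only the odd indices. *)
Definition dbl_fun (A : pred bool) (s : 'S_n) (k : 'I_(2 * n)) :=
  dbl_ord (if A (odd k) then s (half_ord k) else half_ord k) (odd k).

Lemma dbl_fun_inj A s : injective (dbl_fun A s).
Proof.
move=> k l /dbl_ord_inj[ekl ol]; rewrite -(half_ordK k) -(half_ordK l) -ol.
by congr dbl_ord; move: ekl; rewrite ol; case: ifP => // _ /perm_inj.
Qed.

Definition dbl_perm_on A s := perm (@dbl_fun_inj A s).
Definition dbl_perm := dbl_perm_on predT.

Lemma dbl_permE s k : dbl_perm s k = dbl_ord (s (half_ord k)) (odd k).
Proof. by rewrite permE. Qed.

Lemma dbl_perm_inj : injective dbl_perm.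
Proof.
move=> s s' ess; apply/permP=> i; have /permP/(_ (dbl_ord i false)) := ess.
by rewrite !dbl_permE dbl_ordK => /dbl_ord_inj[].
Qed.

Definition swap_fun (k : 'I_(2 * n)) := dbl_ord (half_ord k) (~~ odd k).

Lemma swap_funK : involutive swap_fun.
Proof.
by move=> k; rewrite /swap_fun dbl_ordK odd_dbl_ord negbK half_ordK.
Qed.

(* [dbl_perm s] is the product of its restrictions to the odd and to the even
   indices, and these are conjugate. *)
Lemma odd_dbl_perm s : odd_perm (dbl_perm s) = false.
Proof.
pose c := perm (inv_inj swap_funK).
have -> : dbl_perm s = (dbl_perm_on id s * dbl_perm_on id s ^ c)%g.
  apply/permP=> k; rewrite permM conjgE !permM.
  have cV l : (c^-1)%g l = swap_fun l.
    by apply: (@perm_inj _ c); rewrite permKV permE swap_funK.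
  rewrite cV !permE /dbl_fun /swap_fun !(dbl_ordK, odd_dbl_ord) !negbK.
  by case: (odd k).
by rewrite odd_permM odd_permJ addbb.
Qed.

Lemma prod_dbl_ord (R : nzRingType) (f : 'I_(2 * n) -> R) :
  \prod_(k < 2 * n) f k =
    \prod_(i < n) (f (dbl_ord i false) * f (dbl_ord i true)).
Proof.
(* Extending [f] to all of nat, with a default never read here, allows induction on n without
   changing index types. *)
pose g k := oapp f 1 (insub k).
have gE k : f k = g (val k) by rewrite /g valK.
under eq_bigr do rewrite gE; under [RHS]eq_bigr do rewrite !gE /=.
move: g {gE} => g; elim: n => [|m IHm]; first by rewrite !big_ord0.
rewrite [RHS]big_ord_recr /= -IHm -!(big_mkord predT) mulnS.
by rewrite !big_nat_recr // mulrA /= addn0 addn1 mul2n.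
Qed.

End Doubling.

(** The factors are the weights r (r + 1) of the odd rows r = 2i + 1; together they run through 1,
    ..., 2n. *)
Lemma prod_dbl_fact n : (\prod_(i < n) (i.*2.+1 * i.*2.+2))%N = (2 * n)`!.
Proof.
elim: n => [|n IHn]; first by rewrite big_ord0.
have -> : (2 * n.+1 = (2 * n).+2)%N by lia.
rewrite big_ord_recr /= IHn !factS -!mul2n mulnC mulnA.
by rewrite [((2 * n).+1 * _)%N]mulnC.
Qed.

(** Decodes a state number into its layer and its remembered column pair. *)
Lemma euclid_uniq m k k' j j' : (j < m)%N -> (j' < m)%N ->
  (k * m + j = k' * m + j')%N -> k = k' /\ j = j'.
Proof.
move=> ltj ltj' e; have m_gt0 : (0 < m)%N by lia.
have ek : k = k'.
  by have := congr1 (divn^~ m) e; rewrite !divnMDl // !divn_small // !addn0.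
by split=> //; move: e; rewrite ek => /addnI.
Qed.

(** * Accepted words and their weights *)

Section Automaton.
Variables (R : nzRingType) (n : nat) (y : 'I_n -> 'I_n -> R).

(* State [k * n + j] means: [k] letters have been read, and the column of
   the next letter must be [2 * j + 1] ([j = 0] and no constraint if [k] is
   even). *)
Definition even_step (r c : 'I_(2 * n)) (p q : nat) :=
  [&& ~~ odd r, ~~ odd c, p == r * n & q == r.+1 * n + half_ord c]%N.

Definition odd_step (r c : 'I_(2 * n)) (p q : nat) :=
  [&& odd r, odd c, p == r * n + half_ord c & q == r.+1 * n]%N.

(** Layers 0, ..., 2n - 1 have n states each; the extra state [ord_max], of number 2n * n, is the
    only one in layer 2n. *)
Definition step_mx (r c : 'I_(2 * n)) : 'M[R]_((2 * n * n).+1) :=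
  \matrix_(p, q)
    if even_step r c p q then y (half_ord r) (half_ord c)
    else if odd_step r c p q then (r * r.+1)%:R else 0.

Lemma step_mx_neq0 r c p q : step_mx r c p q != 0 ->
  even_step r c p q \/ odd_step r c p q.
Proof.
rewrite mxE; case: ifP; first by left.
by move=> _; case: ifP; [right | rewrite eqxx].
Qed.

Definition word_mx (s t : 'S_(2 * n)) : 'M[R]_((2 * n * n).+1) :=
  \prod_(k < 2 * n) step_mx (t k) (s k).

Definition word_fun (s t : 'S_(2 * n)) (k : nat) : 'M[R]_((2 * n * n).+1) :=
  oapp (fun i => step_mx (t i) (s i)) 0 (insub k).

Lemma word_funE s t (k : 'I_(2 * n)) : word_fun s t k = step_mx (t k) (s k).
Proof. by rewrite /word_fun valK. Qed.

Lemma word_mxE s t : word_mx s t = \prod_(k < 2 * n) word_fun s t k.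
Proof. by apply: eq_bigr => k _; rewrite word_funE. Qed.

Lemma word_mx_neq0 s t : word_mx s t ord0 ord_max != 0 ->
  t = 1%g /\ exists w, s = dbl_perm w.
Proof.
rewrite word_mxE => /prod_mx_path[st [st0 _ stX]].
have stP (k : 'I_(2 * n)) : even_step (t k) (s k) (st k) (st k.+1) \/
    odd_step (t k) (s k) (st k) (st k.+1).
  by apply: step_mx_neq0; rewrite -word_funE stX.
have half_lt (c : 'I_(2 * n)) : (c./2 < n)%N := ltn_ord (half_ord c).
have n_gt0 (k : 'I_(2 * n)) : (0 < n)%N by have := ltn_ord k; lia.
(* Every step leaves layer r for layer r + 1, so after k letters the state lies in layer k. *)
have stE k : (k < 2 * n)%N ->
    exists2 j, (j < n)%N & st k = (k * n + j)%N :> nat.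
  elim: k => [|k IHk] ltk; first by exists 0%N; [lia | rewrite st0].
  have [j ltj stk] := IHk (ltnW ltk).
  set kk := Ordinal (ltnW ltk); have := stP kk.
  case=> /and4P[_ _ /eqP estk /eqP estk1]; rewrite /= in estk estk1.
    have [ek _] : k = t kk /\ j = 0%N.
      by apply: (@euclid_uniq n); rewrite ?(n_gt0 kk) // -stk estk addn0.
    by exists (s kk)./2; rewrite ?half_lt // estk1 -ek.
  have [ek _] : k = t kk /\ j = (s kk)./2.
    by apply: (@euclid_uniq n); rewrite ?half_lt // -stk estk.
  by exists 0%N; rewrite ?(n_gt0 kk) // addn0 estk1 -ek.
(* The row read at position k is the layer of the current state. *)
have tE (k : 'I_(2 * n)) : t k = k.
  have [j ltj stk] := stE k (ltn_ord k); apply/val_inj/esym.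
  have n0 := n_gt0 k.
  case: (stP k) => /and4P[_ _ /eqP estk _].
    by have [] := @euclid_uniq n k (t k) j 0 ltj n0; rewrite // -stk estk addn0.
  have [] // := @euclid_uniq n k (t k) j _ ltj (half_lt (s k)).
  by rewrite -stk estk.
have odd_s (k : 'I_(2 * n)) : odd (s k) = odd k.
  case: (stP k) => /and4P[]; rewrite tE; first by move=> /negbTE-> /negbTE->.
  by move=> -> ->.
split; first by apply/permP=> k; rewrite perm1 tE.
pose w i := half_ord (s (dbl_ord i false)).
have sE k : s k = dbl_ord (w (half_ord k)) (odd k).
  rewrite -[LHS]half_ordK odd_s; congr dbl_ord; rewrite /w.
  case odd_k: (odd k); last by rewrite -odd_k half_ordK.
  (* [l] is the even position just before [k]; the state between them stores the column pair of
     [s l], and reading [k] forces [s k] into that pair. *)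
  apply/val_inj/esym; set l := dbl_ord _ _.
  have ekl : k = l.+1 :> nat.
    by rewrite /l -[in LHS](half_ordK k) odd_k /= addn1 addn0.
  have odd_l : odd l = false by rewrite odd_dbl_ord.
  have ltk : (k < 2 * n)%N := ltn_ord k.
  case: (stP l) => /and4P[]; rewrite tE ?odd_l // => _ _ _ /eqP.
  case: (stP k) => /and4P[]; rewrite tE ?odd_k // => _ _ /eqP.
  by rewrite {1 2}ekl => -> _ /addnI.
have w_inj : injective w.
  move=> i j eij.
  have /perm_inj/dbl_ord_inj[] // : s (dbl_ord i false) = s (dbl_ord j false).
  by rewrite !sE !dbl_ordK !odd_dbl_ord eij.
by exists (perm w_inj); apply/permP=> k; rewrite dbl_permE sE permE.
Qed.

Lemma word_mx_dbl_perm w :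
  word_mx (dbl_perm w) 1%g ord0 ord_max =
    (\prod_(i < n) y i (w i)) *+ (2 * n)`!.
Proof.
(* The memory after k letters: the column pair just chosen if k is odd, nothing if k is even. *)
pose mem k := if odd k then oapp (fun i => w i : nat) 0%N (insub k./2) else 0%N.
pose st k : 'I_((2 * n * n).+1) := inord (k * n + mem k).
have memE (k : 'I_(2 * n)) :
    mem k = if odd k then w (half_ord k) : nat else 0%N.
  by rewrite /mem -[k./2]/(val (half_ord k)) valK.
have mem_lt k : (k < 2 * n)%N -> (mem k < n)%N.
  by move=> ltk; rewrite (memE (Ordinal ltk)) /=; case: ifP => //; lia.
have stE k : (k <= 2 * n)%N -> st k = (k * n + mem k)%N :> nat.
  move=> lek; rewrite inordK // ltnS.
  case: (ltngtP k (2 * n)) lek => // [ltk|->] _.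
    by have := mem_lt k ltk; nia.
  by rewrite /mem mul2n odd_double addn0.
have st0 : ord0 = st 0%N by apply/val_inj; rewrite /= stE.
(* Since 2n is even, the run ends with empty memory. *)
have stN : st (2 * n)%N = ord_max.
  by apply/val_inj; rewrite /= stE // /mem mul2n odd_double addn0.
have memS (k : 'I_(2 * n)) :
    mem k.+1 = if odd k then 0%N else w (half_ord k) : nat.
  rewrite /mem /= if_neg; case: ifP => // ok.
  suff -> : uphalf k = half_ord k by rewrite valK.
  by rewrite /= uphalf_half ok.
have stepE (k : 'I_(2 * n)) (r : 'I_((2 * n * n).+1)) :
    step_mx k (dbl_perm w k) (st k) r =
      if odd k then (k * k.+1)%:R *+ (r == st k.+1)
      else y (half_ord k) (w (half_ord k)) *+ (r == st k.+1).
  have ltk : (k < 2 * n)%N := ltn_ord k.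
  rewrite mxE /even_step /odd_step dbl_permE odd_dbl_ord dbl_ordK.
  rewrite -[r == _]val_eqE /= !stE ?(ltnW ltk) // memE memS.
  case: ifP; case: (odd k); rewrite ?addn0 ?eqxx //=.
  - by move=> ->; rewrite mulr1n.
  - by case: eqP.
  - by move=> ->.
rewrite st0 word_mxE prod_mx_det_path => [|k r ltk neq]; last first.
  rewrite (word_funE _ _ (Ordinal ltk)) perm1 (stepE (Ordinal ltk)).
  by rewrite /= (negbTE neq) !mulr0n if_same.
rewrite stN eqxx mulr1n.
under eq_bigr do rewrite word_funE perm1 stepE eqxx !mulr1n.
rewrite prod_dbl_ord -prod_dbl_fact -prodrMn; apply: eq_bigr => i _.
rewrite !odd_dbl_ord dbl_ordK /= addn1 -[RHS]mulr_natr; congr (_ * _).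
Qed.

Lemma sum_word_mx :
  (\sum_(s : 'S_(2 * n)) \sum_(t : 'S_(2 * n))
     ((-1) ^+ s * (-1) ^+ t) * word_mx s t) ord0 ord_max =
  (\sum_(w : 'S_n) \prod_(i < n) y i (w i)) *+ (2 * n)`!.
Proof.
have signE (b c : bool) (A : 'M[R]_((2 * n * n).+1)) p q :
    ((-1) ^+ b * (-1) ^+ c * A) p q = (-1) ^+ b * (-1) ^+ c * A p q.
  by rewrite -!signr_addb !mulr_sign; case: ifP => //; rewrite mxE.
transitivity (\sum_(s : 'S_(2 * n)) (-1) ^+ s * word_mx s 1%g ord0 ord_max).
  rewrite summxE; apply: eq_bigr => s _.
  rewrite summxE (bigD1 1%g) //= signE odd_perm1 mulr1 big1 ?addr0 // => t nt1.
  rewrite signE; case: (eqVneq (word_mx s t ord0 ord_max) 0) => [->|].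
    by rewrite mulr0.
  by move=> /word_mx_neq0[t1]; rewrite t1 eqxx in nt1.
(* Only [t = 1] is left; the [s] outside the image of [dbl_perm] contribute 0, those inside have
   sign +1. *)
rewrite (bigID (fun s => s \in [set dbl_perm w | w : 'S_n])) /=.
rewrite [X in _ + X]big1 ?addr0.
  rewrite big_imset /=; last by move=> ? ? _ _; apply: dbl_perm_inj.
  rewrite -sumrMnl; apply: eq_big => [w|w _]; first by rewrite inE.
  by rewrite odd_dbl_perm mul1r word_mx_dbl_perm.
move=> s; apply: contraNeq => nz.
have [|_ [w ->]] := @word_mx_neq0 s 1%g; last exact: imset_f.
by apply: contraNneq nz => ->; rewrite mulr0.
Qed.

End Automaton.

(** * Matrix substitution in circuits *)

(** Along a closed path the rank of the first node would be smaller than itself. *)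
Lemma ranked_acyclic (V : eqType) (e : rel V) (rank : V -> nat) :
  (forall u v, e u v -> (rank v < rank u)%N) ->
  forall c : seq V, path.cycle e c -> c = [::].
Proof.
move=> dec [|x s] //= es.
have: path (relpre rank gtn) x (rcons s x) by apply: sub_path es.
rewrite (path_sortedE (fun _ _ _ h1 h2 => ltn_trans h2 h1)).
move=> /andP[/allP/(_ x)].
by rewrite mem_rcons inE eqxx /= ltnn => /(_ isT).
Qed.

Section Rank.
Variables (F : fieldType) (I : choiceType) (C : circuit F I).

Definition node_rank (v : node C) : nat :=
  #|connect (fun u w : node C => w \in children (label u)) v|.

(** By acyclicity [u] cannot be reached from its child [v], so strictly fewer nodes are reachable
    from [v]. *)
Lemma node_rank_lt u v : v \in children (label u) ->
  (node_rank v < node_rank u)%N.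
Proof.
move=> euv; apply/proper_card/properP; split.
  by apply/subsetP=> w; apply: connect_trans; apply: connect1.
exists u; first exact: connect0.
apply/negP=> /connectP[s ps Es].
have: path.cycle (fun u w : node C => w \in children (label u)) (v :: s).
  by rewrite /= rcons_path ps -Es.
by move/(@acyclic _ _ C).
Qed.
End Rank.

(** * The universal property of the free algebra *)

Section Eval.
Variables (F : fieldType) (I : choiceType) (S : nzRingType).
Variables (f : {rmorphism F -> S}) (x : I -> S).
Hypothesis f_central : forall c y, GRing.comm (f c) y.

Definition word_eval (m : {fmonom I}) : S := \prod_(i <- (m : seq I)) x i.

Lemma word_eval_mmorphism : mmorphism word_eval.
Proof.
split=> [m1 m2|]; first by rewrite /word_eval fmM big_cat.
by rewrite /word_eval fm1 big_nil.
Qed.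

HB.instance Definition _ :=
  monalg.isMultiplicative.Build {fmonom I} S word_eval word_eval_mmorphism.

(** Evaluate words letter by letter and extend linearly; centrality of the images of scalars makes
    this multiplicative. *)
Lemma ncpoly_universal : exists phi : {rmorphism {ncpoly F[I]} -> S},
  (forall c, phi c%:MP = f c) /\ (forall i, phi (ncvar F i) = x i).
Proof.
pose phi := mmap f word_eval.
have phiM : multiplicative phi.
  by apply: commr_mmap_is_multiplicative => g m m'; apply: f_central.
pose M := GRing.isMonoidMorphism.Build {ncpoly F[I]} S phi (phiM.2, phiM.1).
pose A := GRing.isZmodMorphism.Build {ncpoly F[I]} S phi (raddfB _).
pose P : {rmorphism {ncpoly F[I]} -> S} := HB.pack phi M A.
exists P; split=> [c|i]; first exact: mmapC.
by rewrite /= /phi mmapU /= rmorph1 mul1r /word_eval fmU big_seq1.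
Qed.
End Eval.

Lemma comm_scalar_mx_central (R : nzRingType) (d : nat) (a : R)
    (A : 'M[R]_d.+1) : (forall x, GRing.comm a x) -> GRing.comm a%:M A.
Proof.
move=> comm_a; rewrite /GRing.comm [LHS]mul_scalar_mx.
apply/matrixP=> p q; rewrite !mxE (bigD1 q) //= big1 => [|r nrq].
  by rewrite mxE eqxx mulr1n addr0 comm_a.
by rewrite mxE (negbTE nrq) mulr0n mulr0.
Qed.

Lemma malgC_central (F : fieldType) (J : choiceType) (c : F)
    (g : {ncpoly F[J]}) : GRing.comm c%:MP g.
Proof.
rewrite /GRing.comm mul_malgC malgZ_def [RHS]malgM_def fgmulgU.
by apply: eq_bigr => k _; rewrite mulm1 mulrC.
Qed.

(** * Evaluating a circuit on matrices, entry by entry *)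

Section MatrixSubstitution.
Variables (F : fieldType) (I J : choiceType) (d : nat).

Definition leaf_value (x : F + J) : {ncpoly F[J]} :=
  match x with inl c => c%:MP | inr j => ncvar F j end.

Variable M : I -> 'I_d.+1 -> 'I_d.+1 -> F + J.

Definition leaf_mx (i : I) : 'M[{ncpoly F[J]}]_d.+1 :=
  \matrix_(p, q) leaf_value (M i p q).

Lemma mx_subst_morphism :
  exists phi : {rmorphism {ncpoly F[I]} -> 'M[{ncpoly F[J]}]_d.+1},
    (forall c, phi c%:MP = (c%:MP)%:M) /\
    (forall i, phi (ncvar F i) = leaf_mx i).
Proof.
pose f : {rmorphism F -> 'M[{ncpoly F[J]}]_d.+1} :=
  @scalar_mx _ d.+1 \o @malgC {fmonom J} F.
apply: (@ncpoly_universal F I _ f leaf_mx) => c A.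
by apply: comm_scalar_mx_central => g; apply: malgC_central.
Qed.

Variable C : circuit F I.

(* [inl k] is the sum of the first [k] summands of an entry of a matrix
   product, [inr k] is the [k]-th summand. *)
Definition entry_node : finType :=
  (node C * ('I_d.+1 * 'I_d.+1) * ('I_d.+2 + 'I_d.+1))%type.

Definition entry (v : node C) p q : entry_node := (v, (p, q), inl ord_max).

(** At a node that is not a product, every [inl] copy carries the entry itself and the [inr] copies
    are dummies set to 0. *)
Definition entry_label (u : entry_node) : gate F J entry_node :=
  let: (v, (p, q), x) := u in
  match label v, x with
  | GConst c, inl _ => GConst (c *+ (p == q))
  | GVar i, inl _ =>
      match M i p q with inl c => GConst c | inr j => GVar j end
  | GAdd l r, inl _ => GAdd (entry l p q) (entry r p q)
  | GMul l r, inl k =>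
      if unlift ord0 k is Some k'
      then GAdd (v, (p, q), inl (widen_ord (leqnSn _) k')) (v, (p, q), inr k')
      else GConst 0
  | GMul l r, inr k => GMul (entry l p k) (entry r k q)
  | _, inr _ => GConst 0
  end.

(** A lexicographic rank: the second term is at most d + 2, below the factor [d.+3], and puts
    partial sums above summands. *)
Definition entry_rank (u : entry_node) : nat :=
  node_rank u.1.1 * d.+3 + (if u.2 is inl k then k.+1 else 0).

Lemma entry_rank_lt u v : v \in children (entry_label u) ->
  (entry_rank v < entry_rank u)%N.
Proof.
case: u => [[u [p q]] x] /=.
have childE w p' q' : w \in children (label u) ->
    (entry_rank (entry w p' q') < entry_rank (u, (p, q), x))%N.
  by move=> /node_rank_lt; rewrite /entry_rank /=; case: x => [k|k]; nia.
case Eu: (label u) childE => [c|i|l r|l r] childE;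
  case: x childE => [k|k] childE //=.
- by case: (M i p q).
- by rewrite !inE => /orP[]/eqP->; apply: childE; rewrite !inE eqxx ?orbT.
- case: unliftP => [k' ->|//].
  by rewrite !inE => /orP[]/eqP->; rewrite /entry_rank /= ltn_add2l.
- by rewrite !inE => /orP[]/eqP->; apply: childE; rewrite !inE eqxx ?orbT.
Qed.

Definition entry_circuit (p q : 'I_d.+1) : circuit F J :=
  Circuit (entry (output C) p q) (ranked_acyclic entry_rank_lt).

Lemma entry_circuit_size p q :
  circuit_size (entry_circuit p q) =
    (circuit_size C * (d.+1 * d.+1) * (d.+2 + d.+1))%N.
Proof. by rewrite /circuit_size /= !card_prod card_sum !card_ord. Qed.

Variable phi : {rmorphism {ncpoly F[I]} -> 'M[{ncpoly F[J]}]_d.+1}.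
Hypothesis phiC : forall c, phi c%:MP = (c%:MP)%:M.
Hypothesis phiX : forall i, phi (ncvar F i) = leaf_mx i.

Lemma entry_node_value p0 q0 (v : node C) f : node_value v f -> forall p q,
  @node_value _ _ (entry_circuit p0 q0) (entry v p q) (phi f p q).
Proof.
elim=> {v f} [v c Ev|v i Ev|v l r f g Ev _ IHl _ IHr|
  v l r f g Ev _ IHl _ IHr] p q.
- have -> : phi c%:MP p q = (c *+ (p == q))%:MP.
    by rewrite phiC mxE; case: eqP => // _; rewrite malgC0E.
  by apply: ValConst; rewrite /= Ev.
- rewrite phiX mxE; case EM: (M i p q) => [c|j].
    by apply: ValConst; rewrite /= Ev EM.
  by apply: ValVar; rewrite /= Ev EM.
- by rewrite rmorphD mxE; apply: ValAdd (IHl p q) (IHr p q); rewrite /= Ev.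
pose X := entry_circuit p0 q0.
have valT (k : 'I_d.+1) :
    @node_value _ _ X (v, (p, q), inr k) (phi f p k * phi g k q).
  by apply: ValMul (IHl p k) (IHr k q); rewrite /= Ev.
have valS m (ltm : (m < d.+2)%N) :
    @node_value _ _ X (v, (p, q), inl (Ordinal ltm))
    (\sum_(k < d.+1 | (k < m)%N) phi f p k * phi g k q).
  elim: m ltm => [|m IHm] ltm.
    rewrite big_pred0 // -malgC0E; apply: ValConst => /=; rewrite Ev.
    by case: unliftP => // k' /(congr1 val).
  have em : Ordinal ltm = lift ord0 (Ordinal (ltm : (m < d.+1)%N)).
    exact: val_inj.
  rewrite (bigD1 (Ordinal (ltm : (m < d.+1)%N))) //= addrC.
  rewrite (eq_bigl (fun k : 'I_d.+1 => (k < m)%N)); last first.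
    by move=> k; rewrite -val_eqE /= ltnS ltn_neqAle andbC.
  apply: ValAdd (IHm (ltnW ltm)) (valT _) => /=.
  rewrite Ev em liftK; congr (GAdd (_, _, inl _) _); exact: val_inj.
(* [entry] is the last partial sum, which contains all d + 1 summands. *)
have := valS d.+1 (ltnSn _).
rewrite (eq_bigl predT) => [|k]; last exact: ltn_ord.
rewrite rmorphM mxE /entry (_ : Ordinal _ = ord_max) //; exact: val_inj.
Qed.

End MatrixSubstitution.

(** The normalizing constant becomes a scalar matrix, so it factors out of each entry. *)
Lemma subst_sdet (F : fieldType) (I J : choiceType) (d N : nat)
    (phi : {rmorphism {ncpoly F[I]} -> 'M[{ncpoly F[J]}]_d.+1})
    (X : 'M[{ncpoly F[I]}]_N) (Z : 'I_N -> 'I_N -> 'M[{ncpoly F[J]}]_d.+1)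
    p q :
  (forall c, phi c%:MP = (c%:MP)%:M) -> (forall i j, phi (X i j) = Z i j) ->
  phi (sdet X) p q = (N`!%:R : F)^-1 *:
    (\sum_(s : 'S_N) \sum_(t : 'S_N)
       ((-1) ^+ s * (-1) ^+ t) * \prod_(k < N) Z (t k) (s k)) p q.
Proof.
move=> phiC phiX; rewrite /sdet -mul_malgC rmorphM phiC [LHS]mxE (bigD1 p) //=.
rewrite [X in _ + X]big1 => [|r nrp]; last first.
  by rewrite mxE eq_sym (negbTE nrp) mulr0n mul0r.
rewrite mxE eqxx mulr1n addr0 mul_malgC; congr (_ *: fun_of_matrix _ p q).
rewrite rmorph_sum; apply: eq_bigr => s _; rewrite rmorph_sum.
apply: eq_bigr => t _; rewrite rmorphM rmorphM !rmorph_sign rmorph_prod.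
by congr (_ * _); apply: eq_bigr => k _; apply: phiX.
Qed.

(** * The reduction from [Cperm] to [sdet] *)

Section AutomatonLeaves.
Variables (F : fieldType) (n : nat).

Definition step_leaf (rc : 'I_(2 * n) * 'I_(2 * n))
    (p q : 'I_((2 * n * n).+1)) : F + 'I_n * 'I_n :=
  let: (r, c) := rc in
  if even_step r c p q then inr (half_ord r, half_ord c)
  else inl (if odd_step r c p q then (r * r.+1)%:R else 0).

Lemma leaf_mx_step r c :
  leaf_mx step_leaf (r, c) = step_mx (fun i j => ncvar F (i, j)) r c.
Proof.
apply/matrixP=> p q; rewrite !mxE /step_leaf.
by case: ifP => //= _; case: ifP => _; rewrite /= ?malgC0E ?rmorph_nat.
Qed.

End AutomatonLeaves.

Theorem theorem6p1 (F : fieldType) (charF0 : [pchar F] =i pred0) :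
  poly_size_computable (fun n => sdet (generic_mx F (2 * n))) ->
  poly_size_computable (fun n => Cperm (generic_mx F n)).
Proof.
move=> [b sdet_circuits].
(* [D] takes the value 2n * n + 1 at n, the number of states. *)
pose D : {poly nat} := 'X * 'X + 'X * 'X + 1.
exists (b * (D * D) * (D + 1 + D)) => n.
have [C [size_C value_C]] := sdet_circuits n.
have [phi [phiC phiX]] := mx_subst_morphism (@step_leaf F n).
exists (entry_circuit (@step_leaf F n) C ord0 ord_max); split.
  have -> : (b * (D * D) * (D + 1 + D)).[n] =
      (b.[n] * ((2 * n * n).+1 * (2 * n * n).+1) *
       ((2 * n * n).+2 + (2 * n * n).+1))%N.
    have DE : D.[n] = (2 * n * n).+1 by rewrite /D !hornerE; lia.
    move: D DE => E DE.
    by rewrite !hornerM !hornerD DE hornerC -[(2 * n * n).+2]addn1.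
  by rewrite entry_circuit_size; apply: leq_mul => //; apply: leq_mul.
have := entry_node_value phiC phiX ord0 ord_max value_C ord0 ord_max.
suff -> : phi (sdet (generic_mx F (2 * n))) ord0 ord_max =
    Cperm (generic_mx F n) by [].
(* Characteristic 0 enters here: (2n)! is invertible and cancels the normalization of [sdet]. *)
have fact_neq0 : ((2 * n)`!%:R : F) != 0.
  by rewrite ((pcharf0P F).1 charF0) -lt0n fact_gt0.
pose y i j : {ncpoly F['I_n * 'I_n]} := ncvar F (i, j).
have phi_step r c : phi (generic_mx F (2 * n) r c) = step_mx y r c.
  by rewrite mxE phiX leaf_mx_step.
rewrite (subst_sdet _ _ phiC phi_step).
have := sum_word_mx y; rewrite /word_mx => ->.
rewrite -scaler_nat scalerA mulVf // scale1r.
by apply: eq_bigr => w _; apply: eq_bigr => i _; rewrite mxE.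
Qed.
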